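(* Let $\Lambda=\{\Lambda_\omega\in B(\mathcal{H},\mathcal{K}_\omega):\omega\in\Omega\}$ and $\Lambda^d=\{\Lambda_\omega^d\in B(\mathcal{H},\mathcal{K}_\omega):\omega\in\Omega\}$ be dual continuous $g$-frames with upper bounds $B_\Lambda$ and $B_{\Lambda^d}$ respectively. Let $m\in L^\infty(\Omega,\mu)$ be such that $\|m-1\|_\infty\le\lambda<\frac{1}{\sqrt{B_\Lambda B_{\Lambda^d}}}$ for some $\lambda$. Then $M_{m,\Lambda,\Lambda^d}\in GL(\mathcal{H})$ and $$\frac{1}{1+\lambda\sqrt{B_\Lambda B_{\Lambda^d}}}\|f\|\le\|M_{m,\Lambda,\Lambda^d}^{-1}f\|\le\frac{1}{1-\lambda\sqrt{B_\Lambda B_{\Lambda^d}}}\|f\|,\quad f\in\mathcal{H},$$ and $$M_{m,\Lambda,\Lambda^d}^{-1}=\sum_{k=0}^\infty\big(M_{(1-m),\Lambda,\Lambda^d}\big)^k,$$ where, for all $n\in\mathbb{N}$, $$\Big\|M_{m,\Lambda,\Lambda^d}^{-1}-\sum_{k=0}^n\big(M_{(1-m),\Lambda,\Lambda^d}\big)^k\Big\|\le\frac{(\lambda\sqrt{B_\Lambda B_{\Lambda^d}})^{n+1}}{1-\lambda\sqrt{B_\Lambda B_{\Lambda^d}}}.$$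
   Context: $(\Omega,\mu)$ is a measure space with positive measure $\mu$, $\mathcal{H}$ is a Hilbert space, $\{\mathcal{K}_\omega:\omega\in\Omega\}$ is a family of Hilbert spaces, $B(\mathcal{H},\mathcal{K}_\omega)$ is the space of bounded linear operators, and $GL(\mathcal{H})$ is the set of all invertible bounded linear operators on $\mathcal{H}$. An element $F\in\prod_{\omega\in\Omega}\mathcal{K}_\omega$ is strongly measurable if $F$, as a mapping of $\Omega$ to $\bigoplus_{\omega\in\Omega}\mathcal{K}_\omega$, is measurable. A family $\Lambda=\{\Lambda_\omega\in B(\mathcal{H},\mathcal{K}_\omega):\omega\in\Omega\}$ is a continuous $g$-frame for $\mathcal{H}$ with respect to $\{\mathcal{K}_\omega\}$ if (a) for each $f\in\mathcal{H}$, $\{\Lambda_\omega f:\omega\in\Omega\}$ is strongly measurable, and (b) there are constants $0<A_\Lambda\le B_\Lambda<\infty$ (lower and upper continuous $g$-frame bounds) with $A_\Lambda\|f\|^2\le\int_\Omega\|\Lambda_\omega f\|^2\,d\mu(\omega)\le B_\Lambda\|f\|^2$ for all $f\in\mathcal{H}$. It is a continuous $g$-Bessel family if (a) holds and the right-hand inequality in (b) holds for all $f\in\mathcal{H}$. A continuous $g$-Bessel family $\Theta$ is a dual of a continuous $g$-Bessel family $\Lambda$ if $\langle f,g\rangle=\int_\Omega\langle\Theta_\omega f,\Lambda_\omega g\rangle\,d\mu(\omega)$ for all $f,g\in\mathcal{H}$ (this relation is symmetric in $\Lambda$ and $\Theta$; one says that $\Lambda$ and $\Theta$ are dual). For continuous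 $g$-Bessel families $\Lambda,\Theta$ and $m\in L^\infty(\Omega,\mu)$, the continuous $g$-Bessel multiplier $M_{m,\Lambda,\Theta}:\mathcal{H}\to\mathcal{H}$ is the bounded operator defined by $\langle M_{m,\Lambda,\Theta}f,g\rangle=\int_\Omega m(\omega)\langle\Theta_\omega f,\Lambda_\omega g\rangle\,d\mu(\omega)$ for $f,g\in\mathcal{H}$. *)

(* Defs.v *)
From HB Require Import structures.
From mathcomp Require Import all_boot all_order all_algebra.
From mathcomp Require Import complex sesquilinear.
From mathcomp Require Import all_classical all_reals all_analysis.

Set Implicit Arguments.
Unset Strict Implicit.
Unset Printing Implicit Defensive.

Import Order.TTheory GRing.Theory Num.Theory.
Import numFieldNormedType.Exports.

Local Open Scope classical_set_scope.
Local Open Scope ring_scope.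
Local Open Scope complex_scope.

(* Complex Hilbert spaces. As in [sesquilinear], the inner product is linear in
   its first argument and conjugate-linear in the second. *)
HB.mixin Record NormedModule_isHilbert (R : realType) H
    & CompleteNormedModule R[i] H := {
  dot : {dot H for (@Num.conj R[i])} ;
  dot_norm : forall x : H, dot x x = `|x| ^+ 2 }.

#[short(type="hilbertType")]
HB.structure Definition Hilbert (R : realType) :=
  {H of CompleteNormedModule R[i] H & NormedModule_isHilbert R H}.

(* Over the scalars [R[i]], [`|x|] is an element of [R[i]] (with zero imaginary
   part); [hnorm x] is the same number as an element of [R]. *)
Definition hnorm (R : realType) (H : normedModType R[i]) (x : H) : R :=
  complex.Re `|x|.

Record bounded_op (R : realType) (H K : normedModType R[i]) := BoundedOp {
  bounded_op_fun :> {linear H -> K} ;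
  bounded_opP : exists C : R, forall x, hnorm (bounded_op_fun x) <= C * hnorm x }.

HB.instance Definition _ (R : realType) (H K : normedModType R[i]) :=
  gen_eqMixin (bounded_op H K).
HB.instance Definition _ (R : realType) (H K : normedModType R[i]) :=
  gen_choiceMixin (bounded_op H K).

Fact bounded_op0_subproof (R : realType) (H K : normedModType R[i]) :
  exists C : R, forall x, hnorm ((\0 : {linear H -> K}) x) <= C * hnorm x.
Proof. by exists 0 => x; rewrite mul0r /hnorm /= normr0. Qed.

Definition bounded_op0 (R : realType) (H K : normedModType R[i]) :
  bounded_op H K := BoundedOp (bounded_op0_subproof H K).

Definition opnorm (R : realType) (H K : normedModType R[i]) (T : H -> K) :
    \bar R :=
  ereal_sup [set (hnorm (T x))%:E | x in [set x | hnorm x <= 1]].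

Definition inverse_op (R : realType) (H : normedModType R[i])
    (T S : bounded_op H H) : Prop := cancel T S /\ cancel S T.

Definition GL (R : realType) (H : normedModType R[i]) : set (bounded_op H H) :=
  [set T | exists S : bounded_op H H, inverse_op T S].
Arguments GL {R} H _.

Section gframes.
Context {R : realType} {d : measure_display} {Omega : measurableType d}.
Variable mu : {measure set Omega -> \bar R}.

Definition complex_measurable (h : Omega -> R[i]) : Prop :=
  measurable_fun setT (fun w => complex.Re (h w)) /\
  measurable_fun setT (fun w => complex.Im (h w)).

(* The integral of [h] exists and equals [z]. *)
Definition is_complex_integral (h : Omega -> R[i]) (z : R[i]) : Prop :=
  [/\ mu.-integrable setT (fun w => (complex.Re (h w))%:E),
      mu.-integrable setT (fun w => (complex.Im (h w))%:E) &
      z = (\int[mu]_w complex.Re (h w)) +i* (\int[mu]_w complex.Im (h w))].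

Definition Linfty_norm (h : Omega -> R[i]) : \bar R :=
  Lnorm mu +oo%E (fun w => (hnorm (h w : R[i]^o))%:E).

Definition Linfty (h : Omega -> R[i]) : Prop :=
  complex_measurable h /\ (Linfty_norm h < +oo)%E.

Variables (H : hilbertType R) (K : Omega -> hilbertType R).

(* The Hilbert space, written [\bigoplus_w K w], in which an element of
   [\prod_w K w] takes its values. Only isometric inclusions of the [K w] are
   required of it. This covers the external l^2 direct sum with its coordinate
   inclusions as well as the case where the [K w] are subspaces of one Hilbert
   space (for instance [K w = C] for all [w]). *)
Record ambient_space := AmbientSpace {
  ambient :> hilbertType R ;
  ambient_incl : forall w, {linear K w -> ambient} ;
  ambient_isometry : forall w x, hnorm (ambient_incl w x) = hnorm x }.

Variable S : ambient_space.

Definition strongly_measurable (F : forall w, K w) : Prop :=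
  measurable_fun setT (fun w =>
    ambient_incl S w (F w) : g_sigma_algebraType (@open (ambient S))).

Definition opfamily := forall w, bounded_op H (K w).

Implicit Types (Lambda Theta : opfamily) (m : Omega -> R[i]).

Definition gframe_energy Lambda (f : H) : \bar R :=
  (\int[mu]_w (hnorm (Lambda w f) ^+ 2)%:E)%E.

(* [Lambda] is a continuous g-frame with lower bound [A], upper bound [B]. *)
Definition continuous_gframe Lambda (A B : R) : Prop :=
  [/\ forall f, strongly_measurable (fun w => Lambda w f),
      0 < A, A <= B &
      forall f, ((A * hnorm f ^+ 2)%:E <= gframe_energy Lambda f
                 <= (B * hnorm f ^+ 2)%:E)%E].

(* [Theta] is a dual of [Lambda]. *)
Definition gdual Lambda Theta : Prop :=
  forall f g : H, is_complex_integral
    (fun w => dot (Theta w f) (Lambda w g)) (dot f g).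

(* The multiplier M_{m,Lambda,Theta}: the unique bounded operator satisfying the
   weak identity below ([bounded_op0] if there is none). *)
Definition multiplier m Lambda Theta : bounded_op H H :=
  xget (bounded_op0 H H) [set M | forall f g : H, is_complex_integral
    (fun w => m w * dot (Theta w f) (Lambda w g)) (dot (M f) g)].

End gframes.

(* Main.v *)
From HB Require Import structures.
Require Import Defs.
From mathcomp Require Import all_boot all_order all_algebra.
From mathcomp Require Import complex sesquilinear.
From mathcomp Require Import all_classical all_reals all_analysis.
From mathcomp Require Import measurable_realfun ess_sup_inf ring lra.

Set Implicit Arguments.
Unset Strict Implicit.
Unset Printing Implicit Defensive.

Import Order.TTheory GRing.Theory Num.Theory.
Import numFieldNormedType.Exports.
Import ComplexField.Normc.

Local Open Scope classical_set_scope.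
Local Open Scope ring_scope.
Local Open Scope complex_scope.

(** The operator [N = M_{1-m}] has norm at most [q = lambda * sqrt (B * Bd)],
which is less than 1, and duality says that [M_1] is the identity, so that
[M_m = 1 - N] by linearity of the multiplier in its symbol.  The Neumann series
of [N] then inverts [M_m]; both norm bounds on the inverse and the rate of
convergence are the usual geometric estimates.

The bound on [N] is weak Cauchy-Schwarz: when [normc m <= C] almost everywhere,
[normc (m * <Theta f, Lambda g>)] is at most [C * |Theta f| * |Lambda g|], and
the Bessel bounds control the integral of the product of the two norms.  Rather
than an inequality between L^2 norms, [weighted_dual_form_le] uses the pointwise
inequality [2 a b <= t a^2 + b^2 / t] with the value of [t] that makes the
integrated bound optimal, so that only the two energies are ever integrated.

A multiplier is given by its weak identity, so its existence has to be
established.  The integrand for a general symbol is integrable because the one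
for the symbol 1 is, by duality, and the symbol is essentially bounded.  The
resulting sesquilinear form is bounded and is represented by an operator thanks
to the Riesz theorem.  The latter is proved by minimising
[|x|^2 - 2 l x]: the parallelogram identity makes every minimising sequence
Cauchy, and the vanishing of the first variation at the limit is the
representation formula.  Minimising a real functional suits the real part of a
complex functional; the imaginary part is recovered by evaluating at [i y]. *)

(** * Real-valued norms and completeness *)

Section norm.
Context {R : realType}.

Lemma hnorm_scalar (z : R[i]) : hnorm (z : R[i]^o) = normc z.
Proof. by []. Qed.

Lemma normc_ge0 (z : R[i]) : 0 <= normc z.
Proof. by case: z => a b /=; exact: sqrtr_ge0. Qed.

Lemma Re_le_normc (z : R[i]) : `|complex.Re z| <= normc z.
Proof. by have := normc_ge_Re z; rewrite lecR. Qed.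

Lemma Im_le_normc (z : R[i]) : `|complex.Im z| <= normc z.
Proof.
case: z => a b /=; rewrite -[leLHS]sqrtr_sqr ler_sqrt ?lerDr ?sqr_ge0//.
by rewrite addr_ge0 ?sqr_ge0.
Qed.

Lemma normc_real (a : R) : normc (a%:C) = `|a|.
Proof. by rewrite /= expr0n addr0 sqrtr_sqr. Qed.

(** Multiplying by a phase turns a modulus into a real part, which reduces
    complex Cauchy-Schwarz and triangle inequalities to their real versions. *)
Lemma normc_phase (z : R[i]) :
  exists2 u : R[i], normc u = 1 & u * z = (normc z)%:C.
Proof.
have [->|z0] := eqVneq z 0.
  by exists 1; [exact: normc1 | rewrite mulr0 normc0].
have nz0 : `|z| != 0 by rewrite normr_eq0.
exists (`|z| / z).
  have -> : normc (`|z| / z) = complex.Re `| `|z| / z | by [].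
  by rewrite normf_div normr_id divff.
by rewrite divfK.
Qed.

Section normed.
Variable V : normedModType R[i].
Implicit Types x y : V.

Lemma normr_hnorm x : `|x| = (hnorm x)%:C.
Proof.
rewrite /hnorm; case: `|x| (normr_ge0 x) => a b /=.
by rewrite lecE /= => /andP[/eqP ->].
Qed.

Lemma hnorm_ge0 x : 0 <= hnorm x.
Proof. by have := normr_ge0 x; rewrite normr_hnorm ler0c. Qed.

Lemma hnorm0 : hnorm (0 : V) = 0.
Proof. by rewrite /hnorm normr0. Qed.

Lemma hnorm_eq0 x : hnorm x = 0 -> x = 0.
Proof. by move=> x0; apply/normr0_eq0; rewrite normr_hnorm x0. Qed.

Lemma ler_hnormD x y : hnorm (x + y) <= hnorm x + hnorm y.
Proof. by have := ler_normD x y; rewrite !normr_hnorm -rmorphD lecR. Qed.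

Lemma hnorm_distC x y : hnorm (x - y) = hnorm (y - x).
Proof. by rewrite /hnorm distrC. Qed.

Lemma hnorm_opp x : hnorm (- x) = hnorm x.
Proof. by rewrite /hnorm normrN. Qed.

Lemma hnormZ (a : R[i]) x : hnorm (a *: x) = normc a * hnorm x.
Proof.
by apply: complexI; rewrite -normr_hnorm normrZ normr_hnorm -[`|a|]/(normc a)%:C -rmorphM.
Qed.

End normed.

(** Completeness in quantitative form: the rate [e] passes to the limit, so that
    no continuity argument is needed where the lemma is applied. *)
Lemma cauchy_hnorm_lim (V : completeNormedModType R[i]) (u : nat -> V)
    (e : nat -> R) :
  e n @[n --> \oo] --> 0 ->
  (forall m n, (n <= m)%N -> hnorm (u m - u n) <= e n) ->
  exists l : V, forall n, hnorm (l - u n) <= e n.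
Proof.
move=> e0 ue.
have e_lt (eps : R) : 0 < eps -> \forall n \near \oo, e n < eps.
  move=> eps0; have /cvgrPdist_lt/(_ _ eps0) := e0.
  apply: filterS => n; rewrite sub0r normrN; exact: le_lt_trans (ler_norm _).
have ucv : cvg (u @ \oo).
  apply/cauchy_cvgP/cauchy_exP => eps eps0.
  have epsE : eps = (complex.Re eps)%:C.
    by rewrite RRe_real// gtr0_real.
  have [|N _ Ne] := e_lt (complex.Re eps).
    by rewrite -ltcR -epsE.
  exists (u N); exists N => // n /= Nn.
  rewrite -ball_normE /= epsE normr_hnorm ltcR hnorm_distC.
  exact: le_lt_trans (ue _ _ Nn) (Ne _ (leqnn N)).
exists (lim (u @ \oo)) => n.
apply/ler_addgt0Pr => eps eps0.
have /cvgrPdist_lt/(_ eps%:C) := ucv.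
rewrite ltcR => /(_ eps0)[N _ Nu].
have := Nu (maxn N n) (leq_maxl _ _).
rewrite normr_hnorm ltcR => h.
have -> : lim (u @ \oo) - u n = (u (maxn N n) - u n) + (lim (u @ \oo) - u (maxn N n)).
  by rewrite [RHS]addrC subrKA.
apply: le_trans (ler_hnormD _ _) _; apply: lerD (ltW h).
exact/ue/leq_maxr.
Qed.

End norm.

(** * Hilbert spaces: Cauchy-Schwarz and Riesz representation *)

Section hilbert.
Context {R : realType}.

Section dot.
Variable H : hilbertType R.
Implicit Types x y : H.

Lemma dotC x y : dot x y = conjc (dot y x).
Proof. by have := hermC (dot : {dot H for _}) x y; rewrite expr0 mul1r. Qed.

Lemma dotDl x x' y : dot (x + x') y = dot x y + dot x' y.
Proof. exact: linearDl. Qed.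

Lemma dotDr x y y' : dot x (y + y') = dot x y + dot x y'.
Proof. exact: linearDr. Qed.

Lemma dotZl (a : R[i]) x y : dot (a *: x) y = a * dot x y.
Proof. exact: linearZl_LR. Qed.

Lemma dotZr (a : R[i]) x y : dot x (a *: y) = conjc a * dot x y.
Proof. exact: linearZr_LR. Qed.

Definition rdot x y : R := complex.Re (dot x y).

Lemma rdotC x y : rdot x y = rdot y x.
Proof. by rewrite /rdot dotC; case: (dot y x). Qed.

Lemma rdotDl x x' y : rdot (x + x') y = rdot x y + rdot x' y.
Proof. by rewrite /rdot dotDl; case: (dot x y) => ? ?; case: (dot x' y). Qed.

Lemma rdotDr x y y' : rdot x (y + y') = rdot x y + rdot x y'.
Proof. by rewrite !(rdotC x) rdotDl. Qed.

Lemma rdotZl (a : R) x y : rdot (a%:C *: x) y = a * rdot x y.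
Proof. by rewrite /rdot dotZl; case: (dot x y) => b c /=; rewrite mul0r subr0. Qed.

Lemma rdotZr (a : R) x y : rdot x (a%:C *: y) = a * rdot x y.
Proof. by rewrite !(rdotC x) rdotZl. Qed.

Lemma rdot_norm x : rdot x x = hnorm x ^+ 2.
Proof. by rewrite /rdot dot_norm normr_hnorm -rmorphXn. Qed.

Lemma sqr_hnormD x y :
  hnorm (x + y) ^+ 2 = hnorm x ^+ 2 + rdot x y *+ 2 + hnorm y ^+ 2.
Proof. by rewrite -!rdot_norm rdotDl !rdotDr (rdotC y x); ring. Qed.

Lemma dot_nondegenerate x y : (forall z, dot x z = dot y z) -> x = y.
Proof.
move=> xy; apply/eqP; rewrite -subr_eq0; apply/eqP/hnorm_eq0/eqP.
by rewrite -sqrf_eq0 -rdot_norm /rdot linearBl /= xy subrr.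
Qed.

Lemma rdot_cauchy_schwarz x y : rdot x y <= hnorm x * hnorm y.
Proof.
have [/hnorm_eq0 ->|x0] := eqVneq (hnorm x) 0.
  by rewrite hnorm0 mul0r /rdot linear0l.
have [/hnorm_eq0 ->|y0] := eqVneq (hnorm y) 0.
  by rewrite hnorm0 mulr0 /rdot linear0r.
have xy : 0 < hnorm x * hnorm y *+ 2.
  by rewrite pmulrn_lgt0// mulr_gt0// lt0r ?x0 ?y0 hnorm_ge0.
have := sqr_ge0 (hnorm ((hnorm y)%:C *: x + (- hnorm x)%:C *: y)).
rewrite sqr_hnormD !hnormZ !normc_real normrN !ger0_norm ?hnorm_ge0//.
rewrite rdotZl rdotZr => h.
rewrite -subr_ge0 -(pmulr_rge0 _ xy).
apply: le_trans h _; rewrite le_eqVlt; apply/orP; left; apply/eqP; ring.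
Qed.

Lemma dot_cauchy_schwarz x y : normc (dot x y) <= hnorm x * hnorm y.
Proof.
have [u u1 uE] := normc_phase (dot x y).
have -> : normc (dot x y) = rdot (u *: x) y by rewrite /rdot dotZl uE.
by apply: le_trans (rdot_cauchy_schwarz _ _) _; rewrite hnormZ u1 mul1r.
Qed.

Lemma rdot_cauchy_schwarz_norm x y : `|rdot x y| <= hnorm x * hnorm y.
Proof. exact: le_trans (Re_le_normc _) (dot_cauchy_schwarz _ _). Qed.

(** The representing vector minimises [J x = |x|^2 - 2 l x].  Stating the result
    for real-linear [l] lets it apply to the real part of a linear functional as
    well as of a conjugate-linear one. *)
Lemma real_riesz (l : H -> R) (C : R) :
  (forall x y, l (x + y) = l x + l y) ->
  (forall (a : R) x, l (a%:C *: x) = a * l x) ->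
  (forall x, `|l x| <= C * hnorm x) ->
  exists y, forall x, l x = rdot y x.
Proof.
move=> lD lZ lC.
pose J x := hnorm x ^+ 2 - l x *+ 2.
have JC x : - C ^+ 2 <= J x.
  have := le_trans (ler_norm (l x)) (lC x); have := sqr_ge0 (hnorm x - C).
  by rewrite /J sqrrB [C * _]mulrC; lra.
have Jinf : has_inf [set J x | x in setT].
  split; first by exists (J 0), 0.
  by exists (- C ^+ 2) => _ [x _ <-].
set I := inf [set J x | x in setT].
have IJ x : I <= J x by apply: ge_inf; [exact: Jinf.2|exists x].
pose e n : R := n.+1%:R^-1.
have e_gt0 n : 0 < e n by rewrite invr_gt0.
(* The gap is squared so that the distances below decay like [e n]. *)
have /choice[u uJ] : forall n, exists x, J x < I + e n ^+ 2.
  move=> n; have [|_ [x _ <-] Jx] := @inf_adherent _ _ (e n ^+ 2) _ Jinf.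
    by rewrite exprn_gt0.
  by exists x.
(* The parallelogram identity, with [J] evaluated at the midpoint: two
   near-minimisers are close to each other. *)
have par x y : hnorm (x - y) ^+ 2 <= (J x - I) *+ 2 + (J y - I) *+ 2.
  have := IJ (2^-1%:C *: (x + y)).
  have -> : x - y = x + (- 1)%:C *: y by rewrite rmorphN scaleN1r.
  rewrite /J hnormZ exprMn lZ lD !sqr_hnormD rdotZr hnormZ exprMn !normc_real.
  rewrite normrN1 ger0_norm ?invr_ge0//.
  by rewrite expr1n; lra.
have [||y uy] := @cauchy_hnorm_lim R H u (fun n => 2 * e n).
- rewrite -[X in _ --> X](mulr0 2); apply: cvgM; first exact: cvg_cst.
  exact: cvg_harmonic.
- move=> m n nm; rewrite -(@ler_pXn2r _ 2%N)// ?nnegrE ?hnorm_ge0//; last first.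
    by rewrite mulr_ge0// ltW.
  apply: le_trans (par _ _) _.
  have : e m ^+ 2 <= e n ^+ 2.
    by rewrite ler_pXn2r ?nnegrE ?(ltW (e_gt0 _))// lef_pV2 ?posrE// ler_nat.
  by have := uJ n; have := uJ m; rewrite exprMn; lra.
exists y => x; apply/eqP; rewrite -subr_eq0 -normr_eq0 eq_le normr_ge0 andbT.
pose D := 1 + hnorm x ^+ 2 + hnorm x *+ 2.
have bound n : `|l x - rdot y x| <= D * e n.
  (* [u n] minimises [J] up to [e n ^+ 2]; varying it by [t = e n] and
     [t = - e n] in the direction [x] bounds the derivative of [J] by a multiple
     of [e n]. *)
  have var t : - e n ^+ 2 <= t ^+ 2 * hnorm x ^+ 2 + t * (rdot (u n) x - l x) *+ 2.
    have := IJ (u n + t%:C *: x); have := uJ n.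
    rewrite /J lD lZ sqr_hnormD hnormZ exprMn normc_real rdotZr real_normK ?num_real//.
    lra.
  have c1 : `|rdot (u n) x - l x| <= e n * (1 + hnorm x ^+ 2).
    have e0 := e_gt0 n.
    have v1 := var (e n); have := var (- e n); rewrite sqrrN.
    move: v1; set c := _ - l x; set h := hnorm x ^+ 2; move: (e n) e0 => t t0 v1 v2.
    have th : 0 <= t ^+ 2 * h by rewrite mulr_ge0 ?sqr_ge0.
    have tt := sqr_ge0 t.
    have E : t * (t * (1 + h)) = t ^+ 2 + t ^+ 2 * h by ring.
    rewrite ler_norml; apply/andP; split; rewrite -(ler_pM2l t0) ?mulrN E;
      move: v1 v2 th tt; rewrite mulNr;
      move: (t * c) (t ^+ 2 * h) (t ^+ 2) => p q r; lra.
  have c2 : `|rdot (y - u n) x| <= 2 * e n * hnorm x.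
    apply: le_trans (rdot_cauchy_schwarz_norm _ _) _.
    by rewrite ler_wpM2r ?hnorm_ge0.
  have -> : l x - rdot y x = - (rdot (u n) x - l x) - rdot (y - u n) x.
    by rewrite -{1}[y](subrK (u n)) rdotDl; ring.
  apply: le_trans (ler_normB _ _) _; rewrite normrN /D.
  by apply: le_trans (lerD c1 c2) _; rewrite le_eqVlt; apply/orP; left; apply/eqP; ring.
apply/ler_addgt0Pr => eps eps0; rewrite add0r.
have D_gt0 : 0 < D by rewrite /D; have := hnorm_ge0 x; nra.
have [n ne] : exists n, e n < eps / D.
  have /cvgrPdist_lt/(_ (eps / D)) := @cvg_harmonic R.
  rewrite divr_gt0// => /(_ isT)[n _ /(_ n (leqnn n))].
  by rewrite sub0r normrN ger0_norm ?ltW// => en; exists n.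
apply: le_trans (bound n) _; rewrite mulrC -ler_pdivlMr//; exact: ltW.
Qed.

(** Testing the bound at [y = x]. *)
Lemma hnorm_le_dot x (c : R) :
  0 <= c -> (forall y, normc (dot x y) <= c * hnorm y) -> hnorm x <= c.
Proof.
move=> c0 xc; have [->//|x0] := eqVneq (hnorm x) 0.
have x_gt0 : 0 < hnorm x by rewrite lt0r x0 hnorm_ge0.
rewrite -(ler_pM2r x_gt0) -expr2 -rdot_norm.
apply: le_trans (xc x); exact: le_trans (ler_norm _) (Re_le_normc _).
Qed.

(** For fixed [x], Riesz applied to the real part of [Phi x] gives [T x]; the
    imaginary parts agree because they are the real parts at [i y]. *)
Lemma bounded_form_representation (Phi : H -> H -> R[i]) (C : R) :
  0 <= C ->
  (forall (a : R[i]) x x' y, Phi (a *: x + x') y = a * Phi x y + Phi x' y) ->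
  (forall (a : R[i]) x y y', Phi x (a *: y + y') = conjc a * Phi x y + Phi x y') ->
  (forall x y, normc (Phi x y) <= C * hnorm x * hnorm y) ->
  exists T : bounded_op H H, forall x y, dot (T x) y = Phi x y.
Proof.
move=> C0 Phil Phir PhiC.
have Phi0 x : Phi x 0 = 0.
  have := Phir 1 x 0 0; rewrite scale1r addr0 conjc1 mul1r => E.
  by apply: (addrI (Phi x 0)); rewrite addr0 -E.
have Phi_rep x : exists z, forall y, dot z y = Phi x y.
  have [y y'|a y|y|z zE] :=
      @real_riesz (fun y => complex.Re (Phi x y)) (C * hnorm x).
  - have := Phir 1 x y y'; rewrite scale1r conjc1 mul1r => ->.
    by case: (Phi x y) => ? ?; case: (Phi x y').
  - have := Phir a%:C x y 0; rewrite Phi0 !addr0 conjc_real => ->.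
    by case: (Phi x y) => b c /=; rewrite mul0r subr0.
  - exact: le_trans (Re_le_normc _) (PhiC _ _).
  exists z => y; have Re_dot y' : complex.Re (dot z y') = complex.Re (Phi x y').
    by rewrite -[LHS]zE.
  apply/eqP; rewrite eq_complex Re_dot eqxx /=; apply/eqP.
  have := Re_dot ('i *: y + 0); rewrite Phir Phi0 !addr0 dotZr.
  case: (dot z y) => a b; case: (Phi x y) => a' b' /=.
  by rewrite !mul0r !mulN1r !opprK !add0r.
have /choice[T TE] := Phi_rep.
have Tlin : linear T.
  move=> a x x'; apply: dot_nondegenerate => y.
  by rewrite dotDl dotZl !TE Phil.
pose Tl : {linear H -> H} := HB.pack T (GRing.isLinear.Build _ _ _ _ T Tlin).
have Tb : exists C', forall x, hnorm (Tl x) <= C' * hnorm x.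
  exists C => x; apply: hnorm_le_dot => [|y]; first by rewrite mulr_ge0 ?hnorm_ge0.
  by rewrite TE; exact: PhiC.
by exists (BoundedOp Tb).
Qed.
End dot.
End hilbert.

(** * The Neumann series *)

Section neumann.
Context {R : realType} (V : completeNormedModType R[i]).
Variables (M N : bounded_op V V) (q : R).
Hypotheses (q_ge0 : 0 <= q) (q_lt1 : q < 1).
Hypotheses (N_le : forall f, hnorm (N f) <= q * hnorm f).
Hypothesis M_def : forall f, M f = f - N f.

Let iter_le k f : hnorm (iter k N f) <= q ^+ k * hnorm f.
Proof.
elim: k => [|k IH]; first by rewrite expr0 mul1r.
by rewrite iterS; apply: le_trans (N_le _) _; rewrite exprS -mulrA ler_wpM2l.
Qed.

Let psum n f := \sum_(0 <= k < n) iter k N f.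

Let M_psum n f : M (psum n f) = f - iter n N f.
Proof.
rewrite /psum; elim: n => [|n IH]; first by rewrite big_geq// linear0 subrr.
by rewrite big_nat_recr//= linearD IH M_def subrKA.
Qed.

Let psum_tail n m f : (n <= m)%N ->
  hnorm (psum m f - psum n f) <= q ^+ n / (1 - q) * hnorm f.
Proof.
have q1 : 0 < 1 - q by rewrite subr_gt0.
move=> /subnKC <-; set p := (m - n)%N.
have -> : psum (n + p) f - psum n f = \sum_(0 <= k < p) iter (n + k) N f.
  rewrite /psum (@big_cat_nat _ _ _ n)//= ?leq_addr// addrAC subrr add0r.
  rewrite -{1}[n]add0n big_addn addnC addnK.
  by apply: eq_bigr => k _; rewrite addnC.
apply: (@le_trans _ _ (\sum_(0 <= k < p) q ^+ (n + k) * hnorm f)).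
  elim: p => [|p IH]; first by rewrite !big_geq// hnorm0.
  rewrite !big_nat_recr//=; apply: le_trans (ler_hnormD _ _) _.
  by apply: lerD => //; exact: iter_le.
rewrite -big_distrl /=; apply: ler_wpM2r; first exact: hnorm_ge0.
under eq_bigr do rewrite exprD.
rewrite -big_distrr /=; apply: ler_wpM2l; first by rewrite exprn_ge0.
rewrite -[leRHS]mul1r ler_pdivlMr// mulrC big_mkord.
rewrite -[1 - q]opprB mulNr -subrX1 opprB gerBl exprn_ge0//.
Qed.

(** [M] sends the [n]-th partial sum at [f] to [f - N^n f], so the limit of the
    partial sums is a right inverse of [M]; injectivity of [M], from [q < 1],
    makes it two-sided, and linear as the inverse of a linear map. *)
Lemma neumann_inverse : exists Minv : bounded_op V V,
  inverse_op M Minv /\ forall n f,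
    hnorm (Minv f - \sum_(0 <= k < n) iter k N f) <= q ^+ n / (1 - q) * hnorm f.
Proof.
have q1 : 0 < 1 - q by rewrite subr_gt0.
have geo0 D : q ^+ n * D @[n --> \oo] --> 0.
  rewrite -[X in _ --> X](mul0r D); apply: cvgM; last exact: cvg_cst.
  by apply: cvg_expr; rewrite ger0_norm.
have tail0 c : q ^+ n / (1 - q) * c @[n --> \oo] --> 0.
  have -> : (fun n => q ^+ n / (1 - q) * c) = (fun n => q ^+ n * ((1 - q)^-1 * c)).
    by apply/funext => n; rewrite mulrA.
  exact: geo0.
have M_inj : injective M.
  move=> f g fg; apply/eqP; rewrite -subr_eq0; apply/eqP/hnorm_eq0/eqP.
  have : M (f - g) = 0 by rewrite linearB fg subrr.
  rewrite M_def => /eqP; rewrite subr_eq0 => /eqP fgN.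
  have := N_le (f - g); rewrite -fgN -subr_ge0 -{2}[hnorm _]mul1r -mulrBl => h.
  rewrite eq_le hnorm_ge0 andbT -(pmulr_rle0 _ q1).
  by rewrite -[1 - q]opprB mulNr oppr_le0.
have /choice[S SE] : forall f, exists g, forall n,
    hnorm (g - psum n f) <= q ^+ n / (1 - q) * hnorm f.
  move=> f; apply: cauchy_hnorm_lim; first exact: tail0.
  by move=> m n; exact: psum_tail.
have [C MC] := bounded_opP M.
have SK : cancel S M.
  move=> f; apply/eqP; rewrite -subr_eq0; apply/eqP/hnorm_eq0/eqP.
  rewrite eq_le hnorm_ge0 andbT.
  pose D := (`|C| / (1 - q) + 1) * hnorm f.
  have MSn n : hnorm (M (S f) - f) <= q ^+ n * D.
    have -> : M (S f) - f = M (S f - psum n f) - iter n N f.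
      by rewrite linearB M_psum opprB -[RHS]addrA addrAC subrr add0r.
    apply: le_trans (ler_hnormD _ _) _; rewrite hnorm_opp.
    have -> : q ^+ n * D = `|C| * (q ^+ n / (1 - q) * hnorm f) + q ^+ n * hnorm f.
      by rewrite /D; ring.
    apply: lerD; last exact: iter_le.
    apply: le_trans (MC _) _; apply: le_trans (ler_wpM2r (hnorm_ge0 _) (ler_norm C)) _.
    by apply: ler_wpM2l => //; exact: SE.
  rewrite -(cvg_lim (@Rhausdorff R) (geo0 D)); apply: limr_ge; last exact: nearW.
  by apply/cvg_ex; exists 0; exact: geo0.
have MK : cancel M S by move=> f; apply: M_inj; rewrite SK.
have Slin : linear S.
  by move=> a f g; apply: M_inj; rewrite linearP !SK.
pose Sl : {linear V -> V} := HB.pack S (GRing.isLinear.Build _ _ _ _ S Slin).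
have Sb : exists C', forall f, hnorm (Sl f) <= C' * hnorm f.
  by exists (1 - q)^-1 => f; have := SE f 0%N; rewrite /psum big_geq// subr0 expr0 mul1r.
by exists (BoundedOp Sb); split => [|n f]; [split | exact: SE].
Qed.

End neumann.

(** * Integrals of complex functions *)

Section integral.
Context {R : realType} {d : measure_display} {Omega : measurableType d}.
Variable mu : {measure set Omega -> \bar R}.
Implicit Types (h k m : Omega -> R[i]) (z : R[i]).

Lemma ae_le_integrable (f g : Omega -> \bar R) :
  measurable_fun [set: Omega] f ->
  {ae mu, forall w, (`|f w| <= `|g w|)%E} ->
  mu.-integrable setT g -> mu.-integrable setT f.
Proof.
move=> mf fg /integrableP[mg g_fin]; apply/integrableP; split=> //.
apply: le_lt_trans g_fin; apply: ae_ge0_le_integral => //.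
- exact: measurableT_comp.
- exact: measurableT_comp.
- by apply: filterS fg.
Qed.

Lemma Rintegral_lincomb (p q : R) (f g k : Omega -> R) :
  mu.-integrable setT (EFin \o f) -> mu.-integrable setT (EFin \o g) ->
  mu.-integrable setT (EFin \o k) ->
  mu.-integrable setT (fun w => (p * f w + q * g w + k w)%:E) /\
  \int[mu]_w (p * f w + q * g w + k w) =
    p * (\int[mu]_w f w) + q * (\int[mu]_w g w) + \int[mu]_w k w.
Proof.
move=> fi gi ki.
have pf : mu.-integrable setT (EFin \o (fun w => p * f w)).
    exact: (integrableZl measurableT p fi).
have qg : mu.-integrable setT (EFin \o (fun w => q * g w)).
    exact: (integrableZl measurableT q gi).
have pfqg : mu.-integrable setT (EFin \o (fun w => p * f w + q * g w)).
  exact: (integrableD measurableT pf qg).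
by split; [exact: (integrableD measurableT pfqg ki) | rewrite !RintegralD// !RintegralZl].
Qed.

Lemma complex_integral_unique h z z' :
  is_complex_integral mu h z -> is_complex_integral mu h z' -> z = z'.
Proof. by move=> [_ _ ->] [_ _ ->]. Qed.

Lemma complex_integral0 : is_complex_integral mu (fun=> 0) 0.
Proof. by split; rewrite ?integrable0//= /Rintegral integral0. Qed.

Lemma complex_integralP (a : R[i]) h k z z' :
  is_complex_integral mu h z -> is_complex_integral mu k z' ->
  is_complex_integral mu (fun w => a * h w + k w) (a * z + z').
Proof.
move=> [hr hi ->] [kr ki ->]; case: a => p q.
have [ri rE] := Rintegral_lincomb p (- q) hr hi kr.
have [ii iE] := Rintegral_lincomb p q hi hr ki.
have ReE w : complex.Re ((p +i* q) * h w + k w) =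
    p * complex.Re (h w) + - q * complex.Im (h w) + complex.Re (k w).
  by case: (h w) => ? ?; case: (k w) => ? ? /=; rewrite mulNr.
have ImE w : complex.Im ((p +i* q) * h w + k w) =
    p * complex.Im (h w) + q * complex.Re (h w) + complex.Im (k w).
  by case: (h w) => ? ?; case: (k w) => ? ?.
have -> : (fun w => (p +i* q) * h w + k w) = fun w =>
    (p * complex.Re (h w) + - q * complex.Im (h w) + complex.Re (k w)) +i*
    (p * complex.Im (h w) + q * complex.Re (h w) + complex.Im (k w)).
  by apply/funext => w; rewrite -ReE -ImE; case: (_ + _).
by split=> //=; rewrite rE iE mulNr.
Qed.

Lemma complex_integralZ (a : R[i]) h z : is_complex_integral mu h z ->
  is_complex_integral mu (fun w => a * h w) (a * z).
Proof.
move=> hz; have := complex_integralP a hz complex_integral0.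
by rewrite addr0; under eq_fun do rewrite addr0.
Qed.

(** After a rotation by the phase of [z], [normc z] is the integral of a real
    part. *)
Lemma normc_complex_integral_le h z (G : Omega -> R) :
  is_complex_integral mu h z -> measurable_fun [set: Omega] G -> (forall w, 0 <= G w) ->
  {ae mu, forall w, normc (h w) <= G w} ->
  ((normc z)%:E <= \int[mu]_w (G w)%:E)%E.
Proof.
move=> hz mG G0 hG; have [u u1 uz] := normc_phase z.
have [uhi _ uE] := complex_integralZ u hz.
have -> : normc z = \int[mu]_w complex.Re (u * h w).
  by rewrite -[LHS]/(complex.Re (normc z)%:C) -uz uE.
rewrite /Rintegral fineK; last exact: integrable_fin_num.
apply: le_trans (_ : _ <= \int[mu]_w `|(complex.Re (u * h w))%:E|)%E _.
  apply: le_trans (lee_abs _) _; apply: le_abse_integral => //.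
  exact: measurable_int uhi.
apply: ae_ge0_le_integral => //.
- by apply: measurableT_comp => //; exact: measurable_int uhi.
- by move=> w _; rewrite lee_fin.
- exact/measurable_EFinP.
- apply: filterS hG => w hGw _; rewrite lee_fin.
  by apply: le_trans (Re_le_normc _) _; rewrite normcM u1 mul1r.
Qed.

Lemma normc_le_ReIm z : normc z <= `|complex.Re z| + `|complex.Im z|.
Proof.
rewrite -(@ler_pXn2r _ 2%N)// ?nnegrE ?normc_ge0 ?addr_ge0//.
case: z => a b /=; rewrite sqr_sqrtr ?addr_ge0 ?sqr_ge0//.
rewrite sqrrD !real_normK ?num_real// -subr_ge0.
have : 0 <= `|a| * `|b| by rewrite mulr_ge0.
by lra.
Qed.

(** The integrand is dominated by [C * (|Re h| + |Im h|)]. *)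
Lemma complex_integral_mul m h z (C : R) : complex_measurable m -> 0 <= C ->
  {ae mu, forall w, normc (m w) <= C} ->
  is_complex_integral mu h z ->
  exists z', is_complex_integral mu (fun w => m w * h w) z'.
Proof.
move=> [mr mi] C0 mC [hr hi _].
have mhr := (measurable_EFinP _ _).1 (measurable_int _ hr).
have mhi := (measurable_EFinP _ _).1 (measurable_int _ hi).
pose g w := C * (`|complex.Re (h w)| + `|complex.Im (h w)|).
have gi : mu.-integrable setT (EFin \o g).
  exact: (integrableZl measurableT C
    (integrableD measurableT (integrable_abse hr) (integrable_abse hi))).
have mhg : {ae mu, forall w, normc (m w * h w) <= g w}.
  apply: filterS mC => w mCw; rewrite normcM.
  by apply: ler_pM => //; [exact: normc_ge0|exact: normc_ge0|exact: normc_le_ReIm].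
exists ((\int[mu]_w complex.Re (m w * h w)) +i* (\int[mu]_w complex.Im (m w * h w))).
split=> //; apply: ae_le_integrable gi.
- apply/measurable_EFinP.
  rewrite (_ : (fun w => _) = fun w => complex.Re (m w) * complex.Re (h w) -
    complex.Im (m w) * complex.Im (h w)); last first.
    by apply/funext => w; case: (m w) => ? ?; case: (h w).
  by apply: measurable_funB; exact: measurable_funM.
- apply: filterS mhg => w mhw; rewrite lee_fin.
  by rewrite (le_trans (Re_le_normc _))// (le_trans mhw)// ler_norm.
- apply/measurable_EFinP.
  rewrite (_ : (fun w => _) = fun w => complex.Re (m w) * complex.Im (h w) +
    complex.Im (m w) * complex.Re (h w)); last first.
    by apply/funext => w; case: (m w) => ? ?; case: (h w).
  by apply: measurable_funD; exact: measurable_funM.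
- apply: filterS mhg => w mhw; rewrite lee_fin.
  by rewrite (le_trans (Im_le_normc _))// (le_trans mhw)// ler_norm.
Qed.

(** The essential supremum norm is 0 by convention when [mu] is the zero measure;
    the almost everywhere bound is then vacuous. *)
Lemma Linfty_norm_ae h (C : R) : (Linfty_norm mu h <= C%:E)%E ->
  0 <= C /\ {ae mu, forall w, normc (h w) <= C}.
Proof.
move=> hC; split; first by rewrite -lee_fin (le_trans _ hC)// Lnorm_ge0.
move: hC; rewrite /Linfty_norm unlock /=; case: ifPn => [mu0 /ess_supP|].
  apply: filterS => w /=; rewrite lee_fin hnorm_scalar.
  by rewrite ger0_norm// normc_ge0.
rewrite -leNgt measure_le0 => /eqP mu0 _.
by exists setT; split.
Qed.

Lemma Linfty_ae m : Linfty mu m ->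
  exists2 C, 0 <= C & {ae mu, forall w, normc (m w) <= C}.
Proof.
move=> [_ mfin]; have [|C0 mC] := @Linfty_norm_ae m (fine (Linfty_norm mu m)).
  by rewrite fineK// ge0_fin_numE// Lnorm_ge0.
by exists (fine (Linfty_norm mu m)).
Qed.

End integral.

(** * Multipliers of Bessel families *)

Section gframes.
Context {R : realType} {d : measure_display} {Omega : measurableType d}.
Variable mu : {measure set Omega -> \bar R}.
Variables (H : hilbertType R) (K : Omega -> hilbertType R) (S : ambient_space K).

(** Strong measurability refers to the ambient space, in which the norm is
    continuous; the inclusions being isometric, the norm can be computed there. *)
Lemma measurable_hnorm (F : forall w, K w) : strongly_measurable S F ->
  measurable_fun [set: Omega] (fun w => hnorm (F w)).
Proof.
move=> mF; have -> : (fun w => hnorm (F w)) =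
    fun w => hnorm (ambient_incl S w (F w)).
  by apply/funext => w; rewrite ambient_isometry.
apply: (measurability _ (RGenOInfty.measurableE R)) => _ [_ [r ->] <-].
have -> : (fun w => hnorm (ambient_incl S w (F w))) @^-1` `]r, +oo[%classic =
    (fun w => ambient_incl S w (F w)) @^-1` [set v : S | r < hnorm v].
  by apply/seteqP; split=> w /=; rewrite in_itv /= andbT.
apply: mF => //; apply: sub_sigma_algebra.
rewrite /= openE => v /= rv; apply/nbhs_ballP.
exists (hnorm v - r)%:C => /=; first by rewrite ltcR subr_gt0.
move=> v'; rewrite -ball_normE /= normr_hnorm ltcR.
have := ler_hnormD (v - v') v'; rewrite subrK; lra.
Qed.

(** The bound is taken positive, as upper frame bounds are, so that one may divide
    by its square root. *)
Definition gBessel (Lambda : opfamily H K) (B : R) : Prop :=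
  [/\ forall f, strongly_measurable S (fun w => Lambda w f), 0 < B &
      forall f, (gframe_energy mu Lambda f <= (B * hnorm f ^+ 2)%:E)%E].

Lemma gframe_gBessel Lambda A B : continuous_gframe mu S Lambda A B ->
  gBessel Lambda B.
Proof.
move=> [mL A0 AB E]; split=> //; first exact: lt_le_trans AB.
by move=> f; have /andP[] := E f.
Qed.

Section pair.
Variables (Lambda Theta : opfamily H K) (BL BT : R).
Hypotheses (LB : gBessel Lambda BL) (TB : gBessel Theta BT).

Let sqr_hnorm_measurable (Xi : opfamily H K) B f : gBessel Xi B ->
  measurable_fun [set: Omega] (fun w => hnorm (Xi w f) ^+ 2).
Proof. by move=> [mX _ _]; apply: measurable_funX; exact: measurable_hnorm. Qed.

Lemma weighted_energy_le (p r : R) f g : 0 <= p -> 0 <= r ->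
  (\int[mu]_w (p * hnorm (Theta w f) ^+ 2 + r * hnorm (Lambda w g) ^+ 2)%:E <=
   (p * (BT * hnorm f ^+ 2) + r * (BL * hnorm g ^+ 2))%:E)%E.
Proof.
move=> p0 r0.
have mT := sqr_hnorm_measurable f TB; have mL := sqr_hnorm_measurable g LB.
under eq_integral do rewrite EFinD.
rewrite ge0_integralD//=; first last.
- by apply/measurable_EFinP; exact: measurable_funM.
- by move=> w _; rewrite lee_fin mulr_ge0 ?sqr_ge0.
- by apply/measurable_EFinP; exact: measurable_funM.
- by move=> w _; rewrite lee_fin mulr_ge0 ?sqr_ge0.
under eq_integral do rewrite EFinM.
under [X in (_ + X)%E]eq_integral do rewrite EFinM.
rewrite !ge0_integralZl_EFin//; try exact/measurable_EFinP;
  try by move=> w _; rewrite lee_fin sqr_ge0.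
have [_ _ LE] := LB; have [_ _ TE] := TB.
rewrite EFinD (EFinM p) (EFinM r).
by apply: leeD; apply: lee_wpmul2l; rewrite ?lee_fin//; [exact: TE | exact: LE].
Qed.

(** The two squares [a ^+ 2] and [b ^+ 2] are weighted so that their integrals are
    both bounded by half of the desired product; this balanced choice turns the
    arithmetic-geometric inequality into Cauchy-Schwarz. *)
Lemma weighted_dual_form_le m (C : R) f g z : 0 <= C ->
  {ae mu, forall w, normc (m w) <= C} ->
  is_complex_integral mu (fun w => m w * dot (Theta w f) (Lambda w g)) z ->
  normc z <= C * Num.sqrt (BL * BT) * hnorm f * hnorm g.
Proof.
move=> C0 mC hz; have [_ BL0 _] := LB; have [_ BT0 _] := TB.
have [f0|f0] := eqVneq f 0.
  rewrite (complex_integral_unique hz (z' := 0)) ?normc0.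
    by rewrite f0 hnorm0 mulr0 mul0r.
  rewrite (_ : (fun _ => _) = fun=> 0); first exact: complex_integral0.
  by apply/funext => w; rewrite f0 linear0 linear0l mulr0.
have [g0|g0] := eqVneq g 0.
  rewrite (complex_integral_unique hz (z' := 0)) ?normc0.
    by rewrite g0 hnorm0 mulr0.
  rewrite (_ : (fun _ => _) = fun=> 0); first exact: complex_integral0.
  by apply/funext => w; rewrite g0 linear0 linear0r mulr0.
have nf0 : 0 < hnorm f.
  by rewrite lt0r hnorm_ge0 andbT; apply: contra_neq f0 => /hnorm_eq0.
have ng0 : 0 < hnorm g.
  by rewrite lt0r hnorm_ge0 andbT; apply: contra_neq g0 => /hnorm_eq0.
pose F := Num.sqrt BT * hnorm f; pose G := Num.sqrt BL * hnorm g.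
have F0 : 0 < F by rewrite mulr_gt0 ?sqrtr_gt0.
have G0 : 0 < G by rewrite mulr_gt0 ?sqrtr_gt0.
pose p := C / 2 * (G / F); pose r := C / 2 * (F / G).
have p0 : 0 <= p by apply: mulr_ge0; apply: divr_ge0 => //; exact: ltW.
have r0 : 0 <= r by apply: mulr_ge0; apply: divr_ge0 => //; exact: ltW.
rewrite -lee_fin.
apply: (@le_trans _ _ (\int[mu]_w
    (p * hnorm (Theta w f) ^+ 2 + r * hnorm (Lambda w g) ^+ 2)%:E)%E).
  apply: (normc_complex_integral_le hz).
  - apply: measurable_funD; apply: measurable_funM => //.
      exact: sqr_hnorm_measurable TB.
    exact: sqr_hnorm_measurable LB.
  - by move=> w; rewrite addr_ge0// mulr_ge0 ?sqr_ge0.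
  - apply: filterS mC => w mw; rewrite normcM.
    apply: (@le_trans _ _ (C * (hnorm (Theta w f) * hnorm (Lambda w g)))).
      by apply: ler_pM => //;
        [exact: normc_ge0 | exact: normc_ge0 | exact: dot_cauchy_schwarz].
    move: (hnorm (Theta w f)) (hnorm (Lambda w g)) => a b.
    (* With [t = G / F], this is [t a^2 + b^2 / t - 2 a b] as a square. *)
    have -> : p * a ^+ 2 + r * b ^+ 2 =
        C * (a * b) + C / 2 * (F * G)^-1 * (G * a - F * b) ^+ 2.
      by rewrite /p /r; field; rewrite !gt_eqF.
    rewrite lerDl; apply: mulr_ge0; last exact: sqr_ge0.
    by apply: mulr_ge0; [exact: divr_ge0 | rewrite invr_ge0; exact/ltW/mulr_gt0].
apply: le_trans (weighted_energy_le f g p0 r0) _; rewrite lee_fin.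
have FE : BT * hnorm f ^+ 2 = F ^+ 2 by rewrite exprMn sqr_sqrtr ?ltW.
have GE : BL * hnorm g ^+ 2 = G ^+ 2 by rewrite exprMn sqr_sqrtr ?ltW.
rewrite FE GE (sqrtrM _ (ltW BL0)) le_eqVlt; apply/orP; left; apply/eqP.
have -> : C * (Num.sqrt BL * Num.sqrt BT) * hnorm f * hnorm g = C * (F * G).
  by rewrite /F /G; ring.
by rewrite /p /r; field; rewrite !gt_eqF.
Qed.

Hypothesis LT_dual : gdual mu Lambda Theta.

(** Duality enters through integrability of the unweighted integrand, which a
    bounded symbol preserves; the form so defined is then represented by an
    operator. *)
Lemma multiplierP m (C : R) : complex_measurable m -> 0 <= C ->
  {ae mu, forall w, normc (m w) <= C} ->
  forall f g, is_complex_integral mu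
    (fun w => m w * dot (Theta w f) (Lambda w g))
    (dot (multiplier mu m Lambda Theta f) g).
Proof.
move=> mm C0 mC.
suff [T TE] : exists T : bounded_op H H, forall f g, is_complex_integral mu
    (fun w => m w * dot (Theta w f) (Lambda w g)) (dot (T f) g).
  exact: (@xgetPex _ (bounded_op0 H H) [set M | forall f g,
    is_complex_integral mu (fun w => m w * dot (Theta w f) (Lambda w g))
      (dot (M f) g)] (ex_intro _ T TE)).
have /choice[Phi PhiE] : forall fg : H * H, exists z, is_complex_integral mu
    (fun w => m w * dot (Theta w fg.1) (Lambda w fg.2)) z.
  move=> fg; exact: complex_integral_mul mm C0 mC (LT_dual fg.1 fg.2).
have [|a f f' g|a f g g'|f g|T TE] :=
    @bounded_form_representation R H (fun f g => Phi (f, g)) (C * Num.sqrt (BL * BT)).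
- by rewrite mulr_ge0 ?sqrtr_ge0.
- apply: (complex_integral_unique (PhiE _)).
  have := complex_integralP a (PhiE (f, g)) (PhiE (f', g)).
  congr is_complex_integral.
  by apply/funext => w; rewrite /= linearP dotDl dotZl; ring.
- apply: (complex_integral_unique (PhiE _)).
  have := complex_integralP (conjc a) (PhiE (f, g)) (PhiE (f, g')).
  congr is_complex_integral.
  by apply/funext => w; rewrite /= linearP dotDr dotZr; ring.
- exact: weighted_dual_form_le (PhiE (f, g)).
by exists T => f g; rewrite TE; exact: PhiE (f, g).
Qed.

Lemma multiplier_le m (C : R) : complex_measurable m -> 0 <= C ->
  {ae mu, forall w, normc (m w) <= C} ->
  forall f, hnorm (multiplier mu m Lambda Theta f) <=
            C * Num.sqrt (BL * BT) * hnorm f.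
Proof.
move=> mm C0 mC f; apply: hnorm_le_dot => [|g].
  by rewrite !mulr_ge0 ?sqrtr_ge0 ?hnorm_ge0.
exact: weighted_dual_form_le (multiplierP mm C0 mC f g).
Qed.

(** By duality the multiplier of symbol 1 satisfies the weak identity of the
    identity operator; the claim is linearity in the symbol. *)
Lemma multiplier_compl m (C C' : R) : complex_measurable m -> 0 <= C -> 0 <= C' ->
  complex_measurable (fun w => 1 - m w) ->
  {ae mu, forall w, normc (m w) <= C} ->
  {ae mu, forall w, normc (1 - m w) <= C'} ->
  forall f, multiplier mu m Lambda Theta f =
            f - multiplier mu (fun w => 1 - m w) Lambda Theta f.
Proof.
move=> mm C0 C0' mm' mC mC' f; apply: dot_nondegenerate => g.
apply: (complex_integral_unique (multiplierP mm C0 mC f g)).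
rewrite linearBl /= addrC -mulN1r.
have := complex_integralP (- 1) (multiplierP mm' C0' mC' f g) (LT_dual f g).
congr is_complex_integral.
by apply/funext => w; ring.
Qed.

End pair.
End gframes.

(** * Operator norms and inversion of the multiplier *)

Lemma opnorm_le (R : realType) (V W : normedModType R[i]) (T : V -> W) (C : R) :
  0 <= C -> (forall f, hnorm (T f) <= C * hnorm f) -> (opnorm T <= C%:E)%E.
Proof.
move=> C0 TC; apply: ge_ereal_sup => _ [f f1 <-]; rewrite lee_fin.
by apply: le_trans (TC f) _; rewrite -[leRHS]mulr1 ler_wpM2l.
Qed.

Lemma opnorm_ge0 (R : realType) (V W : normedModType R[i]) (T : V -> W) :
  (0 <= opnorm T)%E.
Proof.
apply: (@le_trans _ _ (hnorm (T 0))%:E); first by rewrite lee_fin hnorm_ge0.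
by apply: ereal_sup_ubound; exists 0 => //=; rewrite hnorm0.
Qed.

Theorem theorem2p9 (R : realType) (d : measure_display)
    (Omega : measurableType d) (mu : {measure set Omega -> \bar R})
    (H : hilbertType R) (K : Omega -> hilbertType R) (S : ambient_space K)
    (Lambda Lambdad : opfamily H K) (A B Ad Bd : R)
    (m : Omega -> R[i]) (lambda : R) :
  continuous_gframe mu S Lambda A B ->
  continuous_gframe mu S Lambdad Ad Bd ->
  gdual mu Lambda Lambdad ->
  Linfty mu m ->
  (Linfty_norm mu (fun w => (m w - 1)%R) <= lambda%:E)%E ->
  lambda < 1 / Num.sqrt (B * Bd) ->
  let q := lambda * Num.sqrt (B * Bd) in
  let M := multiplier mu m Lambda Lambdad in
  let N := multiplier mu (fun w => 1 - m w) Lambda Lambdad in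
  GL H M /\
  exists Minv : bounded_op H H,
    let err (n : nat) :=
      opnorm (fun f : H => Minv f - \sum_(0 <= k < n.+1) iter k N f) in
    [/\ inverse_op M Minv,
        forall f : H, 1 / (1 + q) * hnorm f <= hnorm (Minv f)
                      <= 1 / (1 - q) * hnorm f,
        err n @[n --> \oo] --> 0%E &
        forall n : nat, (err n <= (q ^+ n.+1 / (1 - q))%:E)%E].
Proof.
move=> /gframe_gBessel LB /gframe_gBessel LdB LLd Lm /Linfty_norm_ae[l0 ml] lq q M N.
have [_ B0 _] := LB; have [_ Bd0 _] := LdB.
have [[mr mi] _] := Lm; have [C C0 mC] := Linfty_ae Lm.
have m1m : complex_measurable (fun w => 1 - m w).
  split.
    rewrite (_ : (fun w => _) = fun w => 1 - complex.Re (m w)).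
      exact: measurable_funB.
    by apply/funext => w; case: (m w).
  rewrite (_ : (fun w => _) = fun w => 0 - complex.Im (m w)).
    exact: measurable_funB.
  by apply/funext => w; case: (m w).
have ml' : {ae mu, forall w, normc (1 - m w) <= lambda}.
  by apply: filterS ml => w; rewrite -opprB normcN.
have q0 : 0 <= q by rewrite mulr_ge0 ?sqrtr_ge0.
have q1 : q < 1 by move: lq; rewrite ltr_pdivlMr ?sqrtr_gt0 ?mulr_gt0.
have N_le f : hnorm (N f) <= q * hnorm f by exact: (multiplier_le LB LdB LLd m1m l0 ml').
have MN f : M f = f - N f by exact: (multiplier_compl LB LdB LLd Lm.1 C0 l0 m1m mC ml').
have [Minv [MinvP Minv_sum]] := neumann_inverse q0 q1 N_le MN.
have q1' : 0 < 1 - q by rewrite subr_gt0.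
have err_le n : (opnorm (fun f : H => (Minv f - \sum_(0 <= k < n.+1) iter k N f)%R)
    <= (q ^+ n.+1 / (1 - q))%:E)%E.
  apply: opnorm_le => [|f]; last exact: Minv_sum.
  by rewrite divr_ge0 ?exprn_ge0// ltW.
split; first by exists Minv.
exists Minv; split=> //.
- move=> f; apply/andP; split.
    (* [f = M (Minv f)] and [M = 1 - N] has norm at most [1 + q]. *)
    rewrite mulrAC mul1r ler_pdivrMr ?ltr_wpDr// mulrC mulrDl mul1r.
    rewrite -{1}[f](MinvP.2 f) MN.
    by apply: le_trans (ler_hnormD _ _) _; rewrite hnorm_opp lerD2l.
  (* The empty partial sum. *)
  have := Minv_sum 0%N f; rewrite big_geq// subr0 expr0; exact.
apply: (@squeeze_cvge _ _ _ _ (cst 0%E) _ (fun n => (q ^+ n.+1 / (1 - q))%:E)).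
- by apply: nearW => n; rewrite opnorm_ge0 err_le.
- exact: cvg_cst.
- apply: cvg_EFin; first exact: nearW.
  rewrite -[X in _ --> X](mul0r (1 - q)^-1); apply: cvgM; last exact: cvg_cst.
  by rewrite (cvg_shiftS (fun n => q ^+ n)); apply: cvg_expr; rewrite ger0_norm.
Qed.
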